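(* Let $1<p<2$. Let $(X_n)_{n\geq 1}$ be a sequence of identically distributed real-valued random variables on a probability space $(\Omega,\mathcal{F},P)$ with finite $p$th moment, i.e. $E|X_1|^p<\infty$. For $t\in[-\pi,\pi)$ let $S_n(t)=\sum_{k=1}^{n}e^{ikt}X_k$. Then for almost all $t\in[-\pi,\pi)$, $$\lim_{n\to\infty}\frac{S_n(t)}{n^{1/p}}=0\qquad P\text{-a.s.}$$
   Context: ''Almost all $t$'' is with respect to Lebesgue measure on $[-\pi,\pi)$; the $P$-null set may depend on $t$. No independence or other dependence assumption is made on the sequence $(X_n)$. Here $i$ denotes the imaginary unit. *)

(* Defs.v *)
From mathcomp Require Import all_boot all_order all_algebra complex.
From mathcomp Require Import all_classical all_reals all_analysis.

Set Implicit Arguments.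
Unset Strict Implicit.
Unset Printing Implicit Defensive.

Import Order.TTheory GRing.Theory Num.Theory.
Import numFieldNormedType.Exports.

Local Open Scope classical_set_scope.
Local Open Scope ring_scope.
Local Open Scope complex_scope.

(* R[i] has no topology of its own in the libraries; seen as a
   numClosedFieldType it inherits the one induced by the modulus. *)
Definition Cplx (R : realType) : numClosedFieldType := R[i].

(* Euler's formula is taken as the definition: the libraries have no complex
   exponential. *)
Definition expC (R : realType) (z : R[i]) : R[i] :=
  (expR (complex.Re z))%:C * (cos (complex.Im z) +i* sin (complex.Im z)).

Definition identically_distributed d (T : measurableType d) (R : realType)
    (P : probability T R) (X Y : {RV P >-> R}) : Prop :=
  forall B : set R, measurable B -> distribution P X B = distribution P Y B.

(* The sequence is indexed from 1; the value [X 0] is never used. The [%C] is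
   needed: a bare ['i] is parsed as the abstract [Num.imaginary]. *)
Definition fourier_sum d (T : measurableType d) (R : realType)
    (P : probability T R) (X : nat -> {RV P >-> R}) (n : nat) (t : R) (w : T) :
    R[i] :=
  \sum_(1 <= k < n.+1) expC ('i%C * (k%:R * t)%:C) * (X k w)%:C.

(* Main.v *)
Require Import Defs.
From mathcomp Require Import all_boot all_order all_algebra complex.
From mathcomp Require Import all_classical all_reals all_analysis.
From mathcomp Require Import measurable_realfun ring lra.

(**
For a fixed outcome put [a_k = X_k / k^(1/p)].  If the series
[sum_k a_k e^(ikt)] converges, Kronecker's lemma gives
[n^(-1/p) sum_(k <= n) X_k e^(ikt) --> 0], so everything rests on that
convergence, for almost all [t].

The sequence [a] is almost surely in [l^q] for every [q > p], and [q] can be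
taken smaller than 2.  Indeed, the expectation of
[sum_k min (1, (|X_k|^p / k)^(q/p))] can be computed with [Y = |X_1|^p] in place
of every [|X_k|^p], since the laws agree, and [sum_k min (1, (Y / k)^(q/p))] is
at most a constant times [Y] ([sum_ratio_powR_le], [ae_cvg_ratio]).  For [a] in
[l^q] with [q < 2] the almost everywhere convergence is the theorem of Menshov,
Paley and Zygmund, valid for every bounded orthogonal system, and more
generally for every system [phi] satisfying Bessel's inequality
([ae_cvg_series]).  It follows from a maximal inequality
[|| sup_j |sum_(k < j) a_k phi_k| ||_2 <= C ||a||_q], proved by the bisection of
Christ and Kiselev ([maximal_majorant]): cutting the index interval where half
of the mass [sum |a_k|^q] has been reached costs one application of Bessel's
inequality, and since [q < 2] the two halves together contribute strictly less
than the whole, so that the recursion closes with a finite constant.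

This yields, for almost every outcome, convergence for almost every [t]; as the
set of pairs (t, outcome) at issue is measurable, Tonelli's theorem exchanges
the two quantifiers ([ae_swap], [bessel_marcinkiewicz]).  The theorem is the
conjunction of the real statements for the systems [cos (k t)] and [sin (k t)]
on [[-pi, pi]].
*)

Set Implicit Arguments.
Unset Strict Implicit.
Unset Printing Implicit Defensive.

Import Order.TTheory GRing.Theory Num.Theory.
Import numFieldNormedType.Exports.

Local Open Scope classical_set_scope.
Local Open Scope ring_scope.
Local Open Scope complex_scope.

(** * The maximal inequality *)

(** Orthogonal systems with [int phi_k^2 <= K] satisfy this by Pythagoras. *)
Definition bessel_system d (T : measurableType d) (R : realType)
    (mu : {measure set T -> \bar R}) (phi : nat -> T -> R) (K : R) : Prop :=
  forall (a : nat -> R) (m n : nat),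
    (\int[mu]_t ((\sum_(m <= k < n) a k * phi k t) ^+ 2)%:E <=
      (K * \sum_(m <= k < n) a k ^+ 2)%:E)%E.

(** This is [||a||_2 <= ||a||_q] with [b = |a|^q] and [rho = 2 / q]. *)
Lemma sum_powR_le (R : realType) (rho : R) (b : nat -> R) m n : 1 <= rho ->
  (forall k, 0 <= b k) ->
  \sum_(m <= k < n) b k `^ rho <= (\sum_(m <= k < n) b k) `^ rho.
Proof.
move=> rho1 b0; set B := \sum_(m <= k < n) b k.
have B0 : 0 <= B by exact: sumr_ge0.
have powE x : 0 <= x -> x `^ rho = x * x `^ (rho - 1).
  by move=> x0; rewrite mulr_powRB1// (lt_le_trans _ rho1).
rewrite (powE _ B0) {1}/B mulr_suml !big_nat ler_sum// => k kmn.
rewrite (powE _ (b0 k)) ler_wpM2l// ge0_ler_powR ?nnegrE ?subr_ge0//.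
rewrite /B (bigD1_seq k) ?mem_index_iota ?iota_uniq//=.
by rewrite lerDl sumr_ge0.
Qed.

(** The term at which the partial sums pass half of the total is left out of
both halves; a single term may carry most of the mass, so that no cut between
two consecutive terms would do. *)
Lemma half_split (R : realType) (b : nat -> R) m n : (forall k, 0 <= b k) -> (m < n)%N ->
  exists k, [/\ (m <= k < n)%N,
    \sum_(m <= i < k) b i <= (\sum_(m <= i < n) b i) / 2 &
    \sum_(k.+1 <= i < n) b i <= (\sum_(m <= i < n) b i) / 2].
Proof.
move=> b0 mn; set B := \sum_(m <= i < n) b i.
have B0 : 0 <= B by exact: sumr_ge0.
have exk : exists k, (m <= k)%N && (B / 2 <= \sum_(m <= i < k.+1) b i).
  exists n.-1; rewrite (ltn_predK mn) -ltnS (ltn_predK mn) mn/= -/B; lra.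
case: (ex_minnP exk) => k /andP[mk Bk] kmin.
have kn : (k < n)%N.
  rewrite -[n](ltn_predK mn) ltnS; apply: kmin.
  rewrite (ltn_predK mn) -ltnS (ltn_predK mn) mn/= -/B; lra.
exists k; split; first by rewrite mk.
- case: k => [|k] in mk Bk kmin kn *; first by rewrite big_geq// divr_ge0.
  have [mk'|mk'] := leqP m k; last by rewrite big_geq ?divr_ge0.
  rewrite leNgt; apply/negP => /ltW h.
  by have := kmin k; rewrite mk' h ltnn => /(_ isT).
- have : B = \sum_(m <= i < k.+1) b i + \sum_(k.+1 <= i < n) b i.
    by rewrite -big_cat_nat//= ltnW.
  lra.
Qed.

Section maximal.
Context d (T : measurableType d) (R : realType).
Variables (mu : {measure set T -> \bar R}) (phi : nat -> T -> R) (K : R).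
Hypothesis mphi : forall k, measurable_fun setT (phi k).
Hypothesis bphi : bessel_system mu phi K.
Hypothesis K0 : 0 <= K.

Let S (a : nat -> R) m n t := \sum_(m <= k < n) a k * phi k t.

Let measurable_S a m n : measurable_fun setT (S a m n).
Proof.
by apply: measurable_sum => k; apply: measurable_funM => //; exact: mphi.
Qed.

(** The maximal function [max_j (sum_(m <= k < j) a_k phi_k)^2] is handled
through a majorant [H], which can be built along the recursion without ever
forming the maximum.  Cut [m, n) at the index [k] of [half_split] and let [Hl],
[Hr] be the majorants of the two halves.  A partial sum stopping after [k] is
[S + y] with [S] the sum over [m, k] and [y^2 <= Hr], whence the majorant
[(1 + 1/e) S^2 + (1 + e) (Hl + Hr)].  Its integral is at most
[(1 + 1/e) K B^rho + (1 + e) C 2 (B/2)^rho] with [B] the total of the [b_k];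
because [rho > 1], some [e] makes [(1 + e) 2^(1 - rho) < 1], and then a suitable
[C] reproduces itself. *)
Lemma maximal_majorant (rho : R) : 1 < rho ->
  exists2 C : R, 0 <= C & forall (a b : nat -> R) (m n : nat),
    (forall k, 0 <= b k) ->
    (forall k, (m <= k < n)%N -> a k ^+ 2 <= b k `^ rho) ->
    exists H : T -> R, [/\ measurable_fun setT H, (forall t, 0 <= H t),
      (forall j t, (j <= n)%N ->
         (\sum_(m <= k < j) a k * phi k t) ^+ 2 <= H t) &
      (\int[mu]_t (H t)%:E <= (C * (\sum_(m <= k < n) b k) `^ rho)%:E)%E].
Proof.
move=> rho1.
(* [e] is chosen so that [(1 + e) th = (1 + th) / 2], and [C] so that
   [D + (1 + th) / 2 * C = C] *)
pose th : R := 2 `^ (1 - rho).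
have th1 : th < 1.
  by rewrite -[ltRHS](powRr0 2) /th /powR ifF ?ifF ?pnatr_eq0// ltr_expR
     ltr_pM2r ?ln_gt0 ?ltr1n// subr_lt0.
have th0 : 0 < th by rewrite powR_gt0.
pose e : R := (1 - th) / (2 * th).
have e0 : 0 < e by rewrite divr_gt0 ?mulr_gt0// subr_gt0.
have eth : (1 + e) * th = (1 + th) / 2 by rewrite /e; field; exact: lt0r_neq0.
pose D : R := (1 + e^-1) * K.
have D0 : 0 <= D by rewrite mulr_ge0// addr_ge0// invr_ge0 ltW.
pose C : R := D * 2 / (1 - th).
have C0 : 0 <= C.
  by apply: divr_ge0; [exact: mulr_ge0|rewrite subr_ge0 ltW].
exists C => // a b m n b0; move: {2}(n - m)%N (leqnn (n - m)) => N.
elim: N m n => [|N IH] m n nmN ab.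
  exists (cst 0); split => //.
    move=> j t jn; rewrite big_geq ?expr0n//.
    by rewrite (leq_trans jn)// -subn_eq0 -leqn0.
  by rewrite integral0 lee_fin mulr_ge0// powR_ge0.
have [nm|mn] := leqP n m.
  by apply: IH => //; rewrite (_ : n - m = 0)%N//; apply/eqP.
have [k [/andP[mk kn] bl br]] := half_split b0 mn.
have [|i /andP[mi ik]|Hl [mHl Hl0 SHl iHl]] := IH m k.
  by rewrite -ltnS (leq_trans _ nmN)// ltn_sub2r.
  by apply: ab; rewrite mi (ltn_trans ik).
have [|i /andP[ki iN]|Hr [mHr Hr0 SHr iHr]] := IH k.+1 n.
  by rewrite -ltnS (leq_trans _ nmN)// ltn_sub2l.
  by apply: ab; rewrite (leq_trans _ ki)//= ltnW.
set B := \sum_(m <= i < n) b i in bl br *.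
pose H t := (1 + e^-1) * S a m k.+1 t ^+ 2 + (1 + e) * (Hl t + Hr t).
have mS2 : measurable_fun setT (fun t => S a m k.+1 t ^+ 2).
  by apply: measurable_funX; exact: measurable_S.
exists H; split.
- by apply: measurable_funD; apply: measurable_funM => //; exact: measurable_funD.
- by move=> t; rewrite addr_ge0// mulr_ge0 ?sqr_ge0 ?addr_ge0 ?invr_ge0// ltW.
- move=> j t jn; have h0 := Hl0 t; have r0 := Hr0 t.
  have s0 : 0 <= (1 + e^-1) * S a m k.+1 t ^+ 2.
    by rewrite mulr_ge0 ?sqr_ge0 ?addr_ge0 ?invr_ge0// ltW.
  have e1 : 0 <= e * (Hl t + Hr t) by rewrite mulr_ge0 ?addr_ge0// ltW.
  have [jk|kj] := leqP j k.
    by have := SHl j t jk; rewrite /H; lra.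
  have := SHr j t jn; rewrite /H.
  rewrite (@big_cat_nat _ _ _ k.+1 m j)//=; last by rewrite ltnW.
  rewrite -/(S a m k.+1 t) -/(S a k.+1 j t).
  set x := S a m _ t; set y := S a _ j t => yr.
  have -> : (x + y) ^+ 2 =
      (1 + e^-1) * x ^+ 2 + (1 + e) * y ^+ 2 - e^-1 * (x - e * y) ^+ 2.
    by field; exact: lt0r_neq0.
  have : 0 <= e^-1 * (x - e * y) ^+ 2 by rewrite mulr_ge0 ?invr_ge0 ?sqr_ge0 ?ltW.
  have : (1 + e) * y ^+ 2 <= (1 + e) * Hr t by rewrite ler_wpM2l// addr_ge0// ltW.
  by have : 0 <= (1 + e) * Hl t; [rewrite mulr_ge0 ?addr_ge0// ltW|lra].
- have -> : (\int[mu]_t (H t)%:E =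
    (1 + e^-1)%:E * \int[mu]_t (S a m k.+1 t ^+ 2)%:E
      + (1 + e)%:E * (\int[mu]_t (Hl t)%:E + \int[mu]_t (Hr t)%:E))%E.
    rewrite -ge0_integralD//; last 4 first.
      by move=> t _; rewrite lee_fin.
      exact/measurable_EFinP.
      by move=> t _; rewrite lee_fin.
      exact/measurable_EFinP.
    rewrite -!ge0_integralZl//; last 6 first.
      by apply/measurable_EFinP/measurable_funD.
      by move=> t _; rewrite lee_fin addr_ge0.
      by rewrite lee_fin addr_ge0// ltW.
      exact/measurable_EFinP.
      by move=> t _; rewrite lee_fin sqr_ge0.
      by rewrite lee_fin addr_ge0// invr_ge0 ltW.
    rewrite -ge0_integralD//.
    + by move=> t _; rewrite lee_fin mulr_ge0 ?sqr_ge0// addr_ge0// invr_ge0 ltW.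
    + by apply/measurable_EFinP/measurable_funM.
    + by move=> t _; rewrite lee_fin mulr_ge0 ?addr_ge0// ltW.
    + by apply/measurable_EFinP/measurable_funM => //; exact: measurable_funD.
  have iS : (\int[mu]_t (S a m k.+1 t ^+ 2)%:E <= (K * B `^ rho)%:E)%E.
    apply: le_trans (bphi _ _ _) _; rewrite lee_fin ler_wpM2l//.
    apply: (@le_trans _ _ (\sum_(m <= i < n) b i `^ rho)); last first.
      exact/sum_powR_le/b0/ltW.
    rewrite [leRHS](@big_cat_nat _ _ _ k.+1)//=; last by rewrite ltnW.
    rewrite -[leLHS]addr0 lerD//; last by apply: sumr_ge0 => i _; exact: powR_ge0.
    rewrite !big_nat ler_sum// => i /andP[mi ik]; apply: ab.
    by rewrite mi (leq_trans ik).
  have halfpow x : 0 <= x -> x <= B / 2 -> x `^ rho <= th / 2 * B `^ rho.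
    move=> x0 xB; have B0 : 0 <= B by lra.
    apply: (@le_trans _ _ ((B / 2) `^ rho)).
      by rewrite ge0_ler_powR ?nnegrE//; lra.
    rewrite powRM ?invr_ge0// mulrC ler_wpM2r ?powR_ge0//.
    rewrite (_ : th / 2 = 2^-1 `^ rho)// /th powRB ?pnatr_eq0 ?implybT//.
    rewrite powRr1// mulrAC divff ?pnatr_eq0// mul1r.
    by rewrite -(@powR_inv1 _ 2)// -powRrM mulN1r powRN.
  have iHl' := le_trans iHl (_ : _ <= (C * (th / 2 * B `^ rho))%:E)%E.
  have iHr' := le_trans iHr (_ : _ <= (C * (th / 2 * B `^ rho))%:E)%E.
  apply: (@le_trans _ _ ((1 + e^-1)%:E * (K * B `^ rho)%:E + (1 + e)%:E *
     ((C * (th / 2 * B `^ rho))%:E + (C * (th / 2 * B `^ rho))%:E))%E).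
    apply: leeD.
      by rewrite lee_wpmul2l// lee_fin addr_ge0// invr_ge0 ltW.
    apply: lee_wpmul2l; first by rewrite lee_fin addr_ge0// ltW.
    apply: leeD.
      by apply: iHl'; rewrite lee_fin ler_wpM2l// halfpow// sumr_ge0.
    by apply: iHr'; rewrite lee_fin ler_wpM2l// halfpow// sumr_ge0.
  rewrite -!(EFinM, EFinD) lee_fin.
  set Br := B `^ rho.
  have -> : (1 + e^-1) * (K * Br) + (1 + e) * (C * (th / 2 * Br) + C * (th / 2 * Br))
    = D * Br + ((1 + e) * th) * C * Br by rewrite /D; field; exact: lt0r_neq0.
  rewrite eth.
  have -> : D = C * (1 - th) / 2 by rewrite /C; field; rewrite subr_eq0 gt_eqF.
  by rewrite le_eqVlt; apply/orP; left; apply/eqP; field.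
Qed.

End maximal.

(** * Almost everywhere convergence of series *)

Lemma limn_einf_ge (R : realType) (u : (\bar R)^nat) (x : \bar R) :
  (\forall n \near \oo, x <= u n)%E -> (x <= limn_einf u)%E.
Proof.
move=> [N _ xu]; rewrite limn_einf_lim; apply: lime_ge.
  exact: is_cvg_einfs.
exists N => // n /= Nn; apply: le_ereal_inf_tmp => _ [k /= nk <-].
by apply: xu => /=; exact: leq_trans nk.
Qed.

Lemma limn_einf_le (R : realType) (u : (\bar R)^nat) (x : \bar R) :
  (forall n, u n <= x)%E -> (limn_einf u <= x)%E.
Proof.
move=> ux; rewrite limn_einf_lim; apply: lime_le.
  exact: is_cvg_einfs.
by apply: nearW => n; apply: ge_ereal_inf; exists (u n) => //; exists n => /=.
Qed.

Lemma measurable_fun_limn_einf d (T : measurableType d) (R : realType)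
    (D : set T) (f : (T -> \bar R)^nat) :
  (forall n, measurable_fun D (f n)) ->
  measurable_fun D (fun x => limn_einf (f ^~ x)).
Proof.
move=> mf; rewrite (_ : (fun _ => _) =
    (fun x => - limn_esup (fun n => - f n x))%E); last first.
  by apply/funext => x; rewrite -limn_einfN; congr limn_einf; apply/funext => n /=;
     rewrite oppeK.
apply: measurableT_comp => //; apply: measurable_fun_limn_esup => n.
exact: measurableT_comp.
Qed.

Section ae_cvg.
Context d (T : measurableType d) (R : realType).
Variables (mu : {measure set T -> \bar R}) (phi : nat -> T -> R) (K : R).
Hypothesis mphi : forall k, measurable_fun setT (phi k).
Hypothesis bphi : bessel_system mu phi K.
Hypothesis K0 : 0 <= K.

(** With [b = |a|^q] and [rho = 2 / q] this is the theorem of Menshov, Paley and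
Zygmund.  The majorants of the partial sums starting at [N] have integrals at
most [C r_N^rho], where [r_N] is the tail of the series of [b].  By Fatou's
lemma so does their lower limit [W_N], which bounds all partial sums starting
at [N]; hence [inf_N W_N] has integral 0, and where it vanishes the series is
Cauchy. *)
Lemma ae_cvg_series (rho : R) (a b : nat -> R) : 1 < rho ->
  (forall k, 0 <= b k) -> cvgn (series b) ->
  (\forall k \near \oo, a k ^+ 2 <= b k `^ rho) ->
  {ae mu, forall t, cvgn (series (fun k => a k * phi k t))}.
Proof.
move=> rho1 b0 cb [N0 _ abN0].
have [C C0 maxineq] := maximal_majorant mphi bphi K0 rho1.
pose r N := limn (series b) - series b N.
have sum_le_r N n : \sum_(N <= k < n) b k <= r N.
  have [Nn|nN] := leqP N n; last first.
    rewrite big_geq ?subr_ge0 1?ltnW// nondecreasing_cvgn_le//.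
    by apply/nondecreasing_seqP => k; rewrite -subr_ge0 seriesSB.
  rewrite /r lerBrDl /series/= -big_cat_nat//.
  apply: (@nondecreasing_cvgn_le _ (series b)) => //.
  by apply/nondecreasing_seqP => k; rewrite -subr_ge0 seriesSB.
have r0 N : 0 <= r N by have := sum_le_r N N; rewrite big_geq.
have rcvg : r N @[N --> \oo] --> 0.
  rewrite -(subrr (limn (series b))); apply: cvgB => //; exact: cvg_cst.
have /choice[H HP] : forall kn : nat * nat, exists H : T -> R,
    [/\ measurable_fun setT H, (forall t, 0 <= H t),
      (forall j t, (j <= kn.2)%N ->
         (\sum_(N0 + kn.1 <= k < j) a k * phi k t) ^+ 2 <= H t) &
      (\int[mu]_t (H t)%:E <= (C * r (N0 + kn.1)%N `^ rho)%:E)%E].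
  move=> [k n]/=; have [i|H [mH H0 SH iH]] := maxineq a b (N0 + k)%N n b0.
    by move=> /andP[ki _]; apply: abN0 => /=; rewrite (leq_trans _ ki)// leq_addr.
  exists H; split => //; apply: le_trans iH _; rewrite lee_fin ler_wpM2l//.
  by rewrite ge0_ler_powR ?nnegrE// ?sumr_ge0// ltW// (lt_trans _ rho1).
pose W k t := limn_einf (fun n => (H (k, n) t)%:E).
have mW k : measurable_fun setT (W k).
  apply: measurable_fun_limn_einf => n; apply/measurable_EFinP.
  by case: (HP (k, n)).
have W0 k t : (0 <= W k t)%E.
  apply: limn_einf_ge; apply: nearW => n; rewrite lee_fin.
  by case: (HP (k, n)).
have iW k : (\int[mu]_t W k t <= (C * r (N0 + k)%N `^ rho)%:E)%E.
  apply: le_trans (fatou _ measurableT _ _) _.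
  - by move=> n; apply/measurable_EFinP; case: (HP (k, n)).
  - by move=> n t _; rewrite lee_fin; case: (HP (k, n)).
  by apply: limn_einf_le => n; case: (HP (k, n)).
pose G t := einfs (W ^~ t) 0%N.
have G0 t : (0 <= G t)%E by apply: le_ereal_inf_tmp => _ [k _ <-].
have mG : measurable_fun setT G by exact: measurable_fun_einfs.
have iG : (\int[mu]_t `|G t| = 0)%E.
  apply/eqP; rewrite eq_le integral_ge0// andbT.
  have rcvg' : (C * r (N0 + k)%N)%:E @[k --> \oo] --> 0%E.
    apply/cvg_EFin; first exact: nearW.
    rewrite -(mulr0 C); apply: cvgM; first exact: cvg_cst.
    move: rcvg; rewrite -(cvg_shiftn N0 r).
    by under eq_fun do rewrite addnC.
  apply: (cvge_to_ge rcvg').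
  have [M _ rM] : \forall k \near \oo, r k < 1.
    by apply: cvgr_lt rcvg _ _; rewrite ltr01.
  exists M => // k /= Mk.
  apply: (@le_trans _ _ (\int[mu]_t W k t)%E).
    apply: ge0_le_integral => //.
      exact: measurableT_comp.
    move=> t _; rewrite gee0_abs//; apply: ge_ereal_inf.
    by exists (W k t) => //; exists k.
  apply: le_trans (iW k) _; rewrite lee_fin ler_wpM2l//.
  have := r0 (N0 + k)%N; rewrite le_eqVlt => /predU1P[<-|rpos].
    by rewrite powR0// gt_eqF// (lt_trans _ rho1).
  apply: ge1r_powR; last exact: ltW.
  rewrite rpos/=; apply/ltW/rM => /=.
  by rewrite (leq_trans Mk)// leq_addl.
have /(ae_eq_integral_abs _ measurableT mG) := iG.
apply: filterS => t /(_ Logic.I) Gt.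
apply: cauchy_cvg; apply/cauchy_exP => e e0.
have : (G t < (e ^+ 2)%:E)%E by rewrite Gt lte_fin exprn_gt0.
move=> /ereal_inf_lt[_ [k _ <-] Wke].
exists (series (fun k => a k * phi k t) (N0 + k)%N).
exists (N0 + k)%N => // n /= Nn; rewrite /ball/= distrC.
rewrite -(ltr_pXn2r (_ : 0 < 2)%N) ?nnegrE ?normr_ge0 ?(ltW e0)//.
rewrite sub_series_geq// real_normK ?num_real// -lte_fin.
apply: le_lt_trans Wke; apply: limn_einf_ge; exists n => // m /= nm.
by rewrite lee_fin; case: (HP (k, m)) => _ _ + _; exact.
Qed.

End ae_cvg.

(** * Real sequences *)

Section real_sequences.
Context (R : realType).

(** Summation by parts.  From an index [N] on, the partial sums of [u] that
start at [N] are small; the quantity [D n] below, the weighted sum minus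
[beta n] times the plain sum, has increments
[- (beta n.+1 - beta n) * \sum_(N <= k < n.+1) u k], so it is small compared
to [beta n]. *)
Lemma kronecker (u beta : nat -> R) :
  {homo beta : m n / (m <= n)%N >-> m <= n} -> (forall n, 0 <= beta n) ->
  beta n @[n --> \oo] --> +oo -> cvgn (series u) ->
  (\sum_(0 <= k < n.+1) beta k * u k) / beta n @[n --> \oo] --> (0 : R).
Proof.
move=> beta_nd beta0 beta_oo cu; apply/cvgrPdist_le => e e0.
have e8 : 0 < e / 8 by rewrite divr_gt0.
have /cauchyP/(_ _ e8)[x [N _ xN]] : cauchy (series u n @[n --> \oo]).
  exact: cvg_cauchy.
have Se n : (N <= n)%N -> `|\sum_(N <= k < n) u k| <= e / 4.
  move=> Nn; rewrite -sub_series_geq//.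
  have /= h1 := xN N (leqnn N); have /= h2 := xN n Nn.
  rewrite -(subrK x (series u n)) -addrA (le_trans (ler_normD _ _))//.
  rewrite (_ : e / 4 = e / 8 + e / 8); last by field.
  by apply: lerD; apply: ltW; [rewrite distrC|].
pose D n := \sum_(N <= k < n.+1) beta k * u k - beta n * \sum_(N <= k < n.+1) u k.
have De n : (N <= n)%N -> `|D n| <= e / 4 * (beta n - beta N).
  elim: n => [|n IH] Nn.
    move: Nn; rewrite leqn0 => /eqP N0.
    by rewrite /D N0 !big_nat1 !subrr mulr0 normr0.
  move: Nn; rewrite leq_eqVlt => /predU1P[Nn|Nn].
    by rewrite -Nn /D !big_nat1 !subrr mulr0 normr0.
  have -> : D n.+1 = D n - (beta n.+1 - beta n) * \sum_(N <= k < n.+1) u k.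
    by rewrite /D !(big_nat_recr n.+1)/= ?(ltnW Nn)//; ring.
  rewrite (_ : e / 4 * (beta n.+1 - beta N) = e / 4 * (beta n - beta N)
    + (beta n.+1 - beta n) * (e / 4)); last by ring.
  rewrite (le_trans (ler_normB _ _))// lerD ?IH// normrM ger0_norm ?subr_ge0 ?beta_nd//.
  by rewrite ler_wpM2l ?subr_ge0 ?beta_nd// Se// ltnW.
pose A := `|\sum_(0 <= k < N) beta k * u k|.
near=> n.
have Nn : (N <= n)%N by near: n; exists N.
have bn : 1 + A * (2 / e) <= beta n by near: n; move: beta_oo => /cvgryPge; exact.
have A0 : 0 <= A by exact: normr_ge0.
have bn0 : 0 < beta n.
  by rewrite (lt_le_trans _ bn)// ltr_pwDl// mulr_ge0// divr_ge0// ltW.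
rewrite sub0r normrN normrM normfV (gtr0_norm bn0) ler_pdivrMr//.
rewrite (@big_cat_nat _ _ _ N)//=; last by rewrite (leq_trans Nn).
rewrite (le_trans (ler_normD _ _))// -/A.
have -> : \sum_(N <= k < n.+1) beta k * u k =
    D n + beta n * \sum_(N <= k < n.+1) u k by rewrite /D subrK.
have /= Dn := De n Nn.
have := ler_normD (D n) (beta n * \sum_(N <= k < n.+1) u k).
rewrite normrM (gtr0_norm bn0).
have : beta n * `|\sum_(N <= k < n.+1) u k| <= beta n * (e / 4).
  by rewrite ler_wpM2l// Se// leqW.
have eA : A <= e / 2 * beta n.
  rewrite (_ : A = e / 2 * (A * (2 / e))); last by field; rewrite gt_eqF.
  by rewrite ler_wpM2l ?divr_ge0 ?ltW//; lra.
have : 0 <= e / 4 * beta N by rewrite mulr_ge0// divr_ge0// ltW.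
lra.
Unshelve. all: by end_near. Qed.

(** The function [y / (y + k)] is a smooth substitute for [min (1, y / k)].  The
sum is compared with a telescoping one: for [g k = (y / (y + k))^s] the
inequality [z^(-s) >= 1 + s (1 - z)], applied to the ratio [z] of two
consecutive arguments, bounds each term by [y / s * (g k - g k.+1)]. *)
Lemma sum_ratio_powR_le (s y : R) n : 0 < s -> 0 <= y ->
  \sum_(0 <= k < n) (y / (y + k.+1%:R)) `^ (1 + s) <= y / s.
Proof.
move=> s0; rewrite le_eqVlt => /predU1P[<-|y0].
  rewrite big1 ?mul0r// => k _.
  by rewrite mul0r powR0// gt_eqF// addr_gt0.
pose g k := (y / (y + k%:R)) `^ s.
have step k : (y / (y + k.+1%:R)) `^ (1 + s) <= y / s * (g k - g k.+1).
  have k0 : 0 < y + k%:R by rewrite ltr_wpDr.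
  have k1 : 0 < y + k.+1%:R by rewrite ltr_wpDr.
  pose z := (y + k%:R) / (y + k.+1%:R).
  have z0 : 0 < z by rewrite divr_gt0.
  have z1 : z - 1 = - (y + k.+1%:R)^-1.
    by rewrite /z -natr1; field; rewrite gt_eqF// natr1.
  have gz : g k = g k.+1 * z `^ (- s).
    have -> : g k.+1 = g k * z `^ s.
      rewrite /g -powRM; [|exact: divr_ge0 (ltW y0) (ltW k0)|exact: ltW].
      congr (_ `^ _); rewrite /z; move: (y + k%:R) (y + k.+1%:R) k0 k1 => u v u0 v0.
      by field; rewrite !gt_eqF.
    by rewrite powRN mulfK// gt_eqF// powR_gt0.
  have zs : 1 + s / (y + k.+1%:R) <= z `^ (- s).
    rewrite /powR (gt_eqF z0) (le_trans _ (expR_ge1Dx _))// lerD2l mulNr -mulrN.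
    rewrite ler_wpM2l ?(ltW s0)// lerNr -z1.
    have := @le_ln1Dx _ (z - 1); rewrite addrCA subrr addr0.
    by apply; rewrite ltrBDl addrN.
  have g0 : 0 <= g k.+1 by exact: powR_ge0.
  have r0 : 0 < y / (y + k.+1%:R) by rewrite divr_gt0.
  rewrite gz powRD; last by rewrite (gt_eqF r0) implybT.
  rewrite (powRr1 (ltW r0)) -/(g k.+1).
  have -> : y / (y + k.+1%:R) * g k.+1 =
    y / s * (g k.+1 * (s / (y + k.+1%:R))).
    move: (y + k.+1%:R) (g k.+1) k1 {r0 g0 zs gz} => v gv v0.
    by field; rewrite !gt_eqF.
  rewrite ler_wpM2l ?(divr_ge0 (ltW y0) (ltW s0))//.
  by rewrite -[X in _ - X]mulr1 -mulrBr ler_wpM2l// lerBrDl.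
apply: (@le_trans _ _ (\sum_(0 <= k < n) y / s * (g k - g k.+1))).
  by apply: ler_sum => k _.
rewrite -mulr_sumr (telescope_sumr_eq (fun i => - g i))//; last first.
  by move=> i _; rewrite opprK addrC.
rewrite /= opprK ler_piMr ?(divr_ge0 (ltW y0) (ltW s0))//.
have -> : g 0%N = 1 by rewrite /g addr0 divff ?powR1// gt_eqF.
by rewrite addrC gerBl powR_ge0.
Qed.

End real_sequences.

(** * Almost sure summability *)

Lemma measurable_fun_powRl d (T : measurableType d) (R : realType) (D : set T)
    (f : T -> R) (p : R) :
  measurable_fun D f -> measurable_fun D (fun x => f x `^ p).
Proof. by move=> mf; exact: (measurableT_comp (measurable_powR p) mf). Qed.

Lemma ae_cvg_series_integral d (T : measurableType d) (R : realType)
    (mu : {measure set T -> \bar R}) (f : nat -> T -> R) (M : R) :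
  (forall k, measurable_fun setT (f k)) -> (forall k t, 0 <= f k t) ->
  (forall n, \sum_(0 <= k < n) \int[mu]_t (f k t)%:E <= M%:E)%E ->
  {ae mu, forall t, cvgn (series (f ^~ t))}.
Proof.
move=> mf f0 iM.
pose F t := (\sum_(k <oo) (f k t)%:E)%E.
have mF : measurable_fun setT F.
  by apply: ge0_emeasurable_sum => [k t _ _|k _];
    [rewrite lee_fin|exact/measurable_EFinP].
have iF : mu.-integrable setT F.
  apply/integrableP; split => //.
  have F0 t : (0 <= F t)%E by apply: nneseries_ge0 => k _ _; rewrite lee_fin.
  under eq_integral do rewrite gee0_abs//.
  rewrite integral_nneseries//; last 2 first.
  - by move=> k; exact/measurable_EFinP.
  - by move=> k t _; rewrite lee_fin.
  apply: (@le_lt_trans _ _ M%:E); last by rewrite ltry.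
  apply: lime_le; last by apply: nearW => n; exact: iM.
  by apply: is_cvg_nneseries => k _ _; apply: integral_ge0 => t _; rewrite lee_fin.
have := integrable_ae measurableT iF; apply: filterS => t /(_ Logic.I) Ft.
apply: nondecreasing_is_cvgn.
  by apply/nondecreasing_seqP => k; rewrite -subr_ge0 seriesSB.
exists (fine (F t)) => _ [n _ <-].
rewrite -lee_fin fineK// /series/= -sumEFin.
by apply: nneseries_lim_ge => k _; rewrite lee_fin.
Qed.

Section identically_distributed.
Context d (T : measurableType d) (R : realType) (P : probability T R).
Variables (X : nat -> {RV P >-> R}) (p : R).
Hypothesis X_id : forall k, identically_distributed (X k) (X 0%N).
Hypothesis X_p : ('E_P[fun w => (`|X 0%N w| `^ p)%R] < +oo)%E.

Let Y k w := `|X k w| `^ p.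

(** The expectation of each term depends on the law of [X 0] alone, so the sum of
the expectations is at most [E |X 0|^p / s] by [sum_ratio_powR_le]. *)
Lemma ae_cvg_ratio (s : R) : 0 < s ->
  {ae P, forall w, cvgn (series (fun k =>
    (`|X k w| `^ p / (`|X k w| `^ p + k.+1%:R)) `^ (1 + s)))}.
Proof.
move=> s0.
pose g k (x : R) := (`|x| `^ p / (`|x| `^ p + k.+1%:R)) `^ (1 + s).
have g0 k x : 0 <= g k x by exact: powR_ge0.
have mabs : measurable_fun setT (fun x : R => `|x| `^ p).
  exact: measurable_fun_powRl.
have mg k : measurable_fun setT (g k).
  apply: measurable_fun_powRl.
  rewrite (_ : (fun x : R => _) =
      (fun x => `|x| `^ p * (`|x| `^ p + k.+1%:R) `^ (-1))); last first.
    by apply/funext => x; rewrite powR_inv1// addr_ge0// powR_ge0.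
  apply: measurable_funM => //; apply: measurable_fun_powRl.
  exact: measurable_funD.
have XY : (\int[P]_w (Y 0%N w)%:E = (fine (\int[P]_w (Y 0%N w)%:E))%:E)%E.
  rewrite fineK// ge0_fin_numE; last first.
    by apply: integral_ge0 => w _; rewrite lee_fin powR_ge0.
  by move: X_p; rewrite unlock.
apply: (@ae_cvg_series_integral _ _ _ P (fun k w => g k (X k w))
  (fine (\int[P]_w (Y 0%N w)%:E) / s)) => [k|k w|n] //.
  exact: measurableT_comp.
have gX k j : (\int[P]_w (g k (X j w))%:E =
    \int[distribution P (X j)]_x (g k x)%:E)%E.
  apply/esym/(@ge0_integral_distribution _ _ _ _ _ P (X j) (EFin \o g k)).
    exact/measurable_EFinP.
  by move=> x; rewrite lee_fin.
have -> : (\sum_(0 <= k < n) \int[P]_w (g k (X k w))%:E =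
    \sum_(0 <= k < n) \int[P]_w (g k (X 0%N w))%:E)%E.
  apply: eq_bigr => k _; apply: etrans (gX k k) (etrans _ (esym (gX k 0%N))).
  by apply: eq_measure_integral => A mA _; exact: X_id.
rewrite -ge0_integral_sum//; last 2 first.
  by move=> k; apply/measurable_EFinP; exact: measurableT_comp.
  by move=> k w _; rewrite lee_fin.
rewrite EFinM -XY muleC -ge0_integralZl//; last 3 first.
- by apply/measurable_EFinP; exact: (measurableT_comp mabs).
- by move=> w _; rewrite lee_fin powR_ge0.
- by rewrite lee_fin invr_ge0 ltW.
apply: ge0_le_integral => //.
- by move=> w _; rewrite sume_ge0// => k _; rewrite lee_fin.
- by apply: emeasurable_sum => k; apply/measurable_EFinP; exact: measurableT_comp.
- apply: emeasurable_funM => //.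
  by apply/measurable_EFinP; exact: (measurableT_comp mabs).
move=> w _; rewrite sumEFin -EFinM lee_fin mulrC.
by apply: sum_ratio_powR_le => //; exact: powR_ge0.
Qed.

End identically_distributed.

(** Once the ratio [y / (y + k.+1)] is below [1/2] one has [y <= k.+1], hence
[y / k.+1 <= 2 y / (y + k.+1)]; so the summable powers of the ratio dominate the
normalized terms.  The equation on the exponents says that
[(|x|^p / k.+1)^(r rho) = (x / k.+1^(1/p))^2]. *)
Lemma near_sqr_le_ratio (R : realType) (p r rho : R) (x : nat -> R) :
  0 < p -> 0 < r -> p * (r * rho) = 2 ->
  cvgn (series (fun k => (`|x k| `^ p / (`|x k| `^ p + k.+1%:R)) `^ r)) ->
  \forall k \near \oo, (x k / k.+1%:R `^ p^-1) ^+ 2 <=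
    ((2 * (`|x k| `^ p / (`|x k| `^ p + k.+1%:R))) `^ r) `^ rho.
Proof.
move=> p0 r0 prho /cvg_series_cvg_0 c0.
have h0 : 0 < (2^-1 : R) `^ r by rewrite powR_gt0.
near=> k.
have ckr : (`|x k| `^ p / (`|x k| `^ p + k.+1%:R)) `^ r < 2^-1 `^ r.
  by near: k; apply: (cvgr_lt _ c0).
set y := `|x k| `^ p in ckr *; have y0 : 0 <= y by exact: powR_ge0.
have k0 : 0 < k.+1%:R :> R by [].
have yk0 : 0 < y + k.+1%:R by rewrite ltr_wpDl.
have ck : y / (y + k.+1%:R) < 2^-1.
  rewrite ltNge; apply/negP => c2.
  by move: ckr; rewrite ltNge ge0_ler_powR// ?nnegrE ?divr_ge0// ltW.
have yk : y / k.+1%:R <= 2 * (y / (y + k.+1%:R)).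
  move: ck; rewrite ltr_pdivrMr// => yk1.
  rewrite mulrCA ler_wpM2l// ler_pdivlMr// mulrC ler_pdivrMr//.
  lra.
have prho' : r * rho = p^-1 * 2 by rewrite -prho mulKf// gt_eqF.
have -> : (x k / k.+1%:R `^ p^-1) ^+ 2 = (y / k.+1%:R) `^ (r * rho).
  rewrite -[LHS]real_normK ?num_real// normrM normfV (ger0_norm (powR_ge0 _ _)).
  rewrite prho' powRrM powR_mulrn ?powR_ge0//; congr (_ ^+ 2).
  rewrite powRM// ?invr_ge0//; congr (_ * _).
    by rewrite /y -powRrM mulfV ?powRr1 ?gt_eqF//.
  by rewrite -(@powR_inv1 _ k.+1%:R)// -powRrM mulN1r powRN.
rewrite -powRrM; apply: ge0_ler_powR => //; rewrite ?nnegrE.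
- by rewrite prho' mulr_ge0// invr_ge0 ltW.
- exact: divr_ge0.
- by rewrite mulr_ge0// divr_ge0// ltW.
Unshelve. all: by end_near. Qed.

(** * Exchanging the exceptional sets *)

(** Both sides say that the complement of [A] is null for the product measure. *)
Lemma ae_swap d1 d2 (T1 : measurableType d1) (T2 : measurableType d2)
    (R : realType) (m1 : {sigma_finite_measure set T1 -> \bar R})
    (m2 : {sigma_finite_measure set T2 -> \bar R}) (A : set (T1 * T2)) :
  measurable A ->
  {ae m2, forall y, {ae m1, forall x, A (x, y)}} ->
  {ae m1, forall x, {ae m2, forall y, A (x, y)}}.
Proof.
move=> mA h.
have mB : measurable (~` A) by exact: measurableC.
pose F := fubini_F m2 (EFin \o (\1_(~` A) : T1 * T2 -> R)).
have mF : measurable_fun setT F by exact: indic_measurable_fun_fubini_tonelli_F.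
have iF : (\int[m1]_x `|F x| = 0)%E.
  under eq_integral do rewrite gee0_abs ?indic_fubini_tonelli_F_ge0//.
  rewrite indic_fubini_tonelli// indic_fubini_tonelli_GE//.
  have mG : measurable_fun setT (m1 \o ysection (~` A)).
    exact: measurable_fun_ysection.
  under eq_integral => y _ do rewrite -[(_ \o _) y]gee0_abs ?measure_ge0//.
  apply/(ae_eq_integral_abs m2 measurableT mG).
  apply: filterS h => y [N [mN N0 AN]] _ /=.
  apply: (subset_measure0 _ mN _ N0); first exact: measurable_ysection.
  by move=> x; rewrite /ysection/= inE => Axy; exact: AN.
move: iF => /(ae_eq_integral_abs m1 measurableT mF).
apply: filterS => x /(_ Logic.I); rewrite /F indic_fubini_tonelli_FE//= => Bx.
exists (xsection (~` A) x); split => //; first exact: measurable_xsection.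
by move=> y Axy; rewrite /xsection/= inE.
Qed.

Lemma measurable_cvg0 d (T : measurableType d) (R : realType)
    (f : nat -> T -> R) : (forall n, measurable_fun setT (f n)) ->
  measurable [set x | f n x @[n --> \oo] --> (0 : R)].
Proof.
move=> mf.
rewrite (_ : [set x | _] =
    (fun x => limn_esup (fun n => `|f n x|%:E)) @^-1` [set 0%E]).
  rewrite -[X in measurable X]setTI.
  by apply: measurable_fun_limn_esup => // n;
    apply/measurable_EFinP/measurableT_comp.
apply/seteqP; split => x /= fx.
  have /cvg_limn_einf_sup[_ ->]// : `|f n x|%:E @[n --> \oo] --> 0%E.
  apply/cvg_EFin; first exact: nearW.
  by rewrite -(normr0 R); exact: cvg_norm.
apply/cvgrPdist_lt => e e0.
have : (limn_esup (fun n => `|f n x|%:E) < e%:E)%E by rewrite fx lte_fin.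
have cinf := @cvg_esups_inf _ (fun n => `|f n x|%:E).
rewrite limn_esup_lim (cvg_lim _ cinf)// => /ereal_inf_lt[_ [N _ <-] fe].
exists N => // n /= Nn; rewrite -lte_fin; apply: le_lt_trans fe.
by rewrite sub0r normrN; apply: ereal_sup_ubound; exists n.
Qed.

(** * The strong law for Bessel systems *)

Section bessel_slln.
Context d1 d (T1 : measurableType d1) (T : measurableType d) (R : realType).
Variables (mu : {sigma_finite_measure set T1 -> \bar R}) (P : probability T R).
Variables (phi : nat -> T1 -> R) (K : R) (X : nat -> {RV P >-> R}) (p : R).
Hypothesis mphi : forall k, measurable_fun setT (phi k).
Hypothesis bphi : bessel_system mu phi K.
Hypothesis K0 : 0 <= K.
Hypothesis p0 : 0 < p.
Hypothesis p2 : p < 2.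
Hypothesis X_id : forall k, identically_distributed (X k) (X 0%N).
Hypothesis X_p : ('E_P[fun w => (`|X 0%N w| `^ p)%R] < +oo)%E.

(** Since the set of pairs (t, w) where the limit is 0 is measurable, it is
enough to find, for almost every fixed [w], a null set of [t]; there
[ae_cvg_series] applies to the coefficients [X k w / k.+1^(1/p)]. *)
Theorem bessel_marcinkiewicz :
  {ae mu, forall t, {ae P, forall w,
    (\sum_(0 <= k < n.+1) X k w * phi k t) / n.+1%:R `^ p^-1
      @[n --> \oo] --> (0 : R)}}.
Proof.
pose f n (z : T1 * T) :=
  (\sum_(0 <= k < n.+1) X k z.2 * phi k z.1) / n.+1%:R `^ p^-1.
have mf n : measurable_fun setT (f n).
  apply: measurable_funM => //; apply: measurable_sum => k.
  apply: measurable_funM.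
    exact: (measurableT_comp (measurable_funPT (X k)) measurable_snd).
  exact: (measurableT_comp (mphi k) measurable_fst).
apply: (ae_swap (measurable_cvg0 mf)).
(* [q = p r] lies strictly between [p] and 2, and [2 / q = r]: the same exponent
   serves for the summability of [b] and for the maximal inequality *)
pose r := Num.sqrt (2 / p).
have r1 : 1 < r by rewrite -sqrtr1 ltr_sqrt ?divr_gt0// ltr_pdivlMr// mul1r.
have r0 : 0 < r by rewrite (lt_trans _ r1).
have prr : p * (r * r) = 2.
  by rewrite -expr2 sqr_sqrtr ?divr_ge0// ?ltW// mulrC divfK// gt_eqF.
have s0 : 0 < r - 1 by rewrite subr_gt0.
have := ae_cvg_ratio X_id X_p s0; apply: filterS => w.
rewrite addrC subrK => cr.
pose b k := (2 * (`|X k w| `^ p / (`|X k w| `^ p + k.+1%:R))) `^ r.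
pose a k := X k w / k.+1%:R `^ p^-1.
have cb : cvgn (series b).
  rewrite (_ : b = (fun k => 2 `^ r *:
      (`|X k w| `^ p / (`|X k w| `^ p + k.+1%:R)) `^ r)).
    exact: is_cvg_seriesZ.
  by apply/funext => k; rewrite /b powRM.
have := ae_cvg_series mphi bphi K0 r1 (fun k => powR_ge0 _ _) cb
  (near_sqr_le_ratio p0 r0 prr cr).
apply: filterS => t ct; rewrite /f/=.
pose beta n : R := n.+1%:R `^ p^-1.
have bb n : 0 < beta n by rewrite powR_gt0.
rewrite (_ : (fun n => _) = (fun n =>
    (\sum_(0 <= k < n.+1) beta k * (a k * phi k t)) / beta n)); last first.
  apply/funext => n; congr (_ / _).
  apply: eq_bigr => k _; rewrite mulrA /a/=; congr (_ * _).
  by rewrite mulrC divfK// gt_eqF.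
apply: kronecker => //.
- by move=> m n mn; apply: ge0_ler_powR; rewrite ?nnegrE ?invr_ge0 ?(ltW p0)// ler_nat.
- by move=> n; exact: ltW.
- apply/cvgryPge => A; near=> n.
  have An : `|A| `^ p <= n%:R by near: n; exact: nbhs_infty_ger.
  apply: le_trans (ler_norm A) _.
  have -> : `|A| = (`|A| `^ p) `^ p^-1.
    by rewrite -powRrM mulfV ?powRr1 ?gt_eqF//.
  apply: ge0_ler_powR; rewrite ?nnegrE ?invr_ge0 ?powR_ge0 ?(ltW p0)//.
  by rewrite (le_trans An)// ler_nat.
Unshelve. all: by end_near. Qed.

End bessel_slln.

(** * The trigonometric system *)

Lemma bessel_systemS d (T : measurableType d) (R : realType)
    (nu : {measure set T -> \bar R})
    (phi : nat -> T -> R) (K : R) :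
  bessel_system nu phi K -> bessel_system nu (fun k => phi k.+1) K.
Proof.
move=> h a m n; have := h (fun k => a k.-1) m.+1 n.+1.
by rewrite big_add1/=; under eq_integral do rewrite big_add1/=.
Qed.

Section trigonometric.
Context (R : realType).
Notation mu := (@lebesgue_measure R).

Lemma is_derive_sum_seq (I : Type) (s : seq I) (h : I -> R -> R) (dh : I -> R)
    (x : R) : (forall i, is_derive x 1 (h i) (dh i)) ->
  is_derive x 1 (fun t => \sum_(i <- s) h i t) (\sum_(i <- s) dh i).
Proof.
move=> dhi; elim: s => [|i s IH].
  under eq_fun do rewrite big_nil; rewrite big_nil.
  exact: is_derive_cst.
under eq_fun do rewrite big_cons; rewrite big_cons.
exact: (is_deriveD (dhi i) IH).
Qed.

Lemma is_derive_sinM (c x : R) :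
  is_derive x 1 (fun t => sin (c * t)) (c * cos (c * x)).
Proof.
have dc : is_derive x 1 (fun t : R => c * t) c.
  by apply: is_derive_eq; rewrite ?scaler0 ?addr0 ?add0r /GRing.scale/= mulr1.
by have := @is_derive1_comp R sin (fun t => c * t) x _ _
  (is_derive_sin _) dc; rewrite mulrC.
Qed.

Lemma is_derive_cosM (c x : R) :
  is_derive x 1 (fun t => cos (c * t)) (c * - sin (c * x)).
Proof.
have dc : is_derive x 1 (fun t : R => c * t) c.
  by apply: is_derive_eq; rewrite ?scaler0 ?addr0 ?add0r /GRing.scale/= mulr1.
by have := @is_derive1_comp R cos (fun t => c * t) x _ _
  (is_derive_cos _) dc; rewrite mulrC.
Qed.

Lemma sin_natpi (n : nat) : sin (n%:R * pi : R) = 0.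
Proof.
elim: n => [|n IH]; first by rewrite mul0r sin0.
by rewrite -natr1 mulrDl mul1r sinDpi IH oppr0.
Qed.

Lemma sin_subnat_pi (j k : nat) : sin ((j%:R - k%:R) * pi : R) = 0.
Proof. by rewrite mulrBl sinB !sin_natpi mul0r mulr0 subrr. Qed.

Lemma is_derive_Ml (c : R) (f : R -> R) (x df : R) :
  is_derive x 1 f df -> is_derive x 1 (fun t => c * f t) (c * df).
Proof. by move=> fdf; exact: (is_deriveZ c fdf). Qed.

(** Taking cosines and sines together, the integrand is
[sum_(j, k) a_j a_k cos ((j - k) t)], which has an explicit primitive whose
off-diagonal terms vanish at both endpoints. *)
Lemma integral_trig_poly (a : nat -> R) m n :
  (\int[mu]_(t in `[(- pi)%R, pi])
     ((\sum_(m <= k < n) a k * cos (k%:R * t)) ^+ 2 +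
      (\sum_(m <= k < n) a k * sin (k%:R * t)) ^+ 2)%:E =
   (2 * pi * \sum_(m <= k < n) a k ^+ 2)%:E)%E.
Proof.
pose f (t : R) := \sum_(m <= j < n) \sum_(m <= k < n) a j * a k * cos ((j%:R - k%:R) * t).
pose G (j k : nat) (t : R) :=
  if j == k then t else (j%:R - k%:R)^-1 * sin ((j%:R - k%:R) * t).
pose F t := \sum_(m <= j < n) \sum_(m <= k < n) a j * a k * G j k t.
have fE t : (\sum_(m <= k < n) a k * cos (k%:R * t)) ^+ 2 +
    (\sum_(m <= k < n) a k * sin (k%:R * t)) ^+ 2 = f t.
  rewrite !expr2 !big_distrlr/= -big_split/=; apply: eq_bigr => j _.
  rewrite -big_split/=; apply: eq_bigr => k _.
  by rewrite mulrBl cosB; ring.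
under eq_integral do rewrite fE.
have dG (j k : nat) (x : R) : is_derive x 1 (G j k) (cos ((j%:R - k%:R) * x)).
  rewrite /G; have [->|jk] := eqVneq j k.
    by rewrite subrr mul0r cos0; exact: is_derive_id.
  have jk0 : j%:R - k%:R != 0 :> R by rewrite subr_eq0 eqr_nat.
  rewrite -[cos _](mulKf jk0).
  exact/is_derive_Ml/is_derive_sinM.
have dF (x : R) : is_derive x 1 F (f x).
  by apply: is_derive_sum_seq => j; apply: is_derive_sum_seq => k; exact: is_derive_Ml.
have cf : continuous f.
  move=> x; apply/differentiable_continuous/derivable1_diffP.
  apply: (@ex_derive _ _ _ _ _ _ _).
  by apply: is_derive_sum_seq => j; apply: is_derive_sum_seq => k;
    exact/is_derive_Ml/is_derive_cosM.
have cF : continuous F.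
  by move=> x; apply/differentiable_continuous/derivable1_diffP;
     exact: (@ex_derive _ _ _ _ _ _ _ (dF x)).
have pi0 : - pi < pi :> R by rewrite gtrN// pi_gt0.
rewrite (continuous_FTC2 pi0 (continuous_subspaceT cf) (F := F)); last 2 first.
- split.
  + by move=> x _; exact: (@ex_derive _ _ _ _ _ _ _ (dF x)).
  + by apply: cvg_at_right_filter; exact: cF.
  + by apply: cvg_at_left_filter; exact: cF.
- by move=> x _; rewrite derive1E; exact: (@derive_val _ _ _ _ _ _ _ (dF x)).
rewrite -EFinB; congr EFin.
rewrite /F -sumrB mulr_sumr; apply: eq_big_nat => j jmn.
rewrite -sumrB (bigD1_seq j) ?mem_index_iota ?iota_uniq//= big1 ?addr0.
  by rewrite /G eqxx; ring.
move=> k kj; rewrite /G eq_sym (negbTE kj) mulrN sinN sin_subnat_pi.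
by rewrite oppr0 !mulr0 subrr.
Qed.

(** Restricting to [[-pi, pi]] by truncation keeps Lebesgue measure, which is
sigma-finite, as the reference measure; [g] is meant to be [cos] or [sin]. *)
Lemma bessel_trig (g : R -> R) : measurable_fun setT g ->
  (forall (a : nat -> R) m n t, (\sum_(m <= k < n) a k * g (k%:R * t)) ^+ 2 <=
    (\sum_(m <= k < n) a k * cos (k%:R * t)) ^+ 2 +
    (\sum_(m <= k < n) a k * sin (k%:R * t)) ^+ 2) ->
  (forall k : nat, measurable_fun setT
     ((fun t => g (k%:R * t)) \_ `[(- pi)%R, pi])) /\
  bessel_system mu (fun k => (fun t => g (k%:R * t)) \_ `[(- pi)%R, pi]) (2 * pi).
Proof.
move=> mg gle.
have mgk (k : nat) : measurable_fun setT (fun t : R => g (k%:R * t)).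
  apply: (measurableT_comp mg); exact: measurable_funM.
split=> [k|a m n].
  by apply/(measurable_restrictT _ _).1 => //; exact: measurable_funTS.
have -> : (\int[mu]_t ((\sum_(m <= k < n)
      a k * ((fun t => g (k%:R * t)) \_ `[(- pi)%R, pi]) t) ^+ 2)%:E =
    \int[mu]_(t in `[(- pi)%R, pi]) ((\sum_(m <= k < n) a k * g (k%:R * t)) ^+ 2)%:E)%E.
  rewrite [RHS]integral_mkcond; apply: eq_integral => t _; rewrite patchE.
  case: ifPn => tD.
    by congr (_ ^+ 2)%:E; apply: eq_bigr => k _; rewrite patchE tD.
  rewrite big1 ?expr0n// => k _.
  by rewrite patchE (negbTE tD) mulr0.
have mtrig (h : R -> R) : measurable_fun setT h ->
    measurable_fun setT (fun t : R => (\sum_(m <= k < n) a k * h (k%:R * t)) ^+ 2).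
  move=> mh; apply: measurable_funX; apply: measurable_sum => k.
  apply: measurable_funM => //; apply: (measurableT_comp mh).
  exact: measurable_funM.
rewrite -integral_trig_poly; apply: ge0_le_integral => //.
- by move=> t _; rewrite lee_fin; exact: sqr_ge0.
- by apply/measurable_EFinP/measurable_funTS; exact: mtrig.
- apply/measurable_EFinP/measurable_funTS/measurable_funD; apply: mtrig.
    exact: continuous_measurable_fun (@continuous_cos R).
  exact: continuous_measurable_fun (@continuous_sin R).
- by move=> t _; rewrite lee_fin; exact: gle.
Qed.

End trigonometric.

(** * Complex sums *)

Lemma cvg_Cplx0 (R : realType) (u v : nat -> R) :
  u n @[n --> \oo] --> (0 : R) -> v n @[n --> \oo] --> (0 : R) ->
  ((u n +i* v n : Cplx R) @[n --> \oo] --> (0 : Cplx R)).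
Proof.
move=> u0 v0; apply/cvgrPdist_lt => -[e1 e2] /=.
rewrite ltcE/= => /andP[/eqP-> e0].
have e20 : 0 < e1 / 2 by rewrite divr_gt0.
near=> n.
have un : `|u n| < e1 / 2.
  by near: n; move/cvgr0Pnorm_lt : u0; apply.
have vn : `|v n| < e1 / 2.
  by near: n; move/cvgr0Pnorm_lt : v0; apply.
rewrite sub0r normrN normc_def/= ltcR.
apply: (@le_lt_trans _ _ (`|u n| + `|v n|)); last by lra.
rewrite -[leRHS]ger0_norm ?addr_ge0// -sqrtr_sqr ler_sqrt ?sqr_ge0//.
rewrite sqrrD !real_normK ?num_real//.
by rewrite -addrA lerD2l lerDr mulrn_wge0// mulr_ge0.
Unshelve. all: by end_near. Qed.

Lemma fourier_sumE d (T : measurableType d) (R : realType) (P : probability T R)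
    (X : nat -> {RV P >-> R}) n t w :
  fourier_sum X n.+1 t w =
    (\sum_(0 <= k < n.+1) X k.+1 w * cos (k.+1%:R * t)) +i*
    (\sum_(0 <= k < n.+1) X k.+1 w * sin (k.+1%:R * t)).
Proof.
rewrite /fourier_sum big_add1/=.
elim: n.+1 => [|{}n IH]; first by rewrite !big_nil.
rewrite !big_nat_recr//= IH /expC.
by simpc; rewrite expR0 !mul1r ![X _ w * _]mulrC.
Qed.

Theorem corollary1p4 (R : realType) (p : R) (hp1 : 1 < p) (hp2 : p < 2)
    (d : measure_display) (T : measurableType d) (P : probability T R)
    (X : nat -> {RV P >-> R})
    (hid : forall m n : nat, (1 <= m)%N -> (1 <= n)%N ->
       identically_distributed (X m) (X n))
    (hmom : ('E_P[fun w : T => (`|X 1%N w| `^ p)%R] < +oo)%E) :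
  {ae (@lebesgue_measure R), forall t : R, t \in `[- pi, pi[ ->
    {ae P, forall w : T,
      (fun n : nat => fourier_sum X n t w / (n%:R `^ p^-1)%:C : Cplx R)
        @ \oo --> (0 : Cplx R)}}.
Proof.
have p0 : 0 < p by rewrite (lt_trans _ hp1).
have pi0 : 0 <= 2 * pi :> R by rewrite mulr_ge0// pi_ge0.
have X_id k : identically_distributed (X k.+1) (X 1%N) by exact: hid.
have [a m n t|mcos bcos] := @bessel_trig R cos
  (continuous_measurable_fun (@continuous_cos R)).
  by rewrite lerDl sqr_ge0.
have [a m n t|msin bsin] := @bessel_trig R sin
  (continuous_measurable_fun (@continuous_sin R)).
  by rewrite lerDr sqr_ge0.
have := bessel_marcinkiewicz (mu := @lebesgue_measure R)
  (X := fun k => X k.+1) (fun k => msin k.+1)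
  (bessel_systemS bsin) pi0 p0 hp2 X_id hmom.
have := bessel_marcinkiewicz (mu := @lebesgue_measure R)
  (X := fun k => X k.+1) (fun k => mcos k.+1)
  (bessel_systemS bcos) pi0 p0 hp2 X_id hmom.
apply: filterS2 => t tcos tsin tpi.
have tD : t \in `[(- pi)%R, pi]%classic.
  by apply/mem_set => /=; move: tpi; rewrite !in_itv/= => /andP[-> /ltW ->].
move: tcos tsin; apply: filterS2 => w wcos wsin.
have E n : (fourier_sum X n.+1 t w / (n.+1%:R `^ p^-1)%:C : Cplx R) =
    (\sum_(0 <= k < n.+1) X k.+1 w *
       ((fun s => cos (k.+1%:R * s)) \_ `[(- pi)%R, pi]) t) / n.+1%:R `^ p^-1 +i*
    ((\sum_(0 <= k < n.+1) X k.+1 w *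
       ((fun s => sin (k.+1%:R * s)) \_ `[(- pi)%R, pi]) t) / n.+1%:R `^ p^-1).
  under eq_bigr do rewrite patchE tD.
  under [X in _ +i* (X / _)]eq_bigr do rewrite patchE tD.
  rewrite fourier_sumE; move: (_ `^ _) (\sum_(_ <= _ < _) _) (\sum_(_ <= _ < _) _).
  by move=> r x y; rewrite -fmorphV/=; simpc.
(* the term [n = 0] is dropped, to match the indexing of [E] *)
rewrite -cvg_shiftS/=; under eq_fun do rewrite E.
exact: cvg_Cplx0 wcos wsin.
Qed.
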